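(* Let $F(X)=X^2+1$ and $\Psi_F(x,y):=\#\{n\le x:\ P^+(n^2+1)\le y\}$, where $n$ runs over positive integers. If $x<y\le x^2$ and $u:=\frac{\log x}{\log y}\in[\frac12,1)$, then $$\Psi_F(x,y)\ \ge\ \{1-u+o(1)\}\,x$$ as $x\to\infty$.
   Context: $P^+(n)$ denotes the largest prime factor of $n\ge1$, with $P^+(1):=1$. *)

(* Defs.v *)
From HB Require Import structures.
From mathcomp Require Import all_boot all_order all_algebra.
From mathcomp Require Import all_classical all_reals all_analysis.

Set Implicit Arguments.
Unset Strict Implicit.
Unset Printing Implicit Defensive.

Import Order.TTheory GRing.Theory Num.Theory.

Local Open Scope ring_scope.

(* [max_pdiv 1 = 1], in accordance with the convention P^+(1) = 1. *)
Definition Pplus (n : nat) : nat := max_pdiv n.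

Definition F (n : nat) : nat := (n ^ 2 + 1)%N.

(* For [x >= 0], the positive integers [n <= x] are those with
   [1 <= n <= Num.truncn x]; [Num.truncn x = 0] when [x < 0]. *)
Definition Psi_F (R : realType) (x y : R) : nat :=
  #|[set n : 'I_(Num.truncn x).+1 | (0 < n)%N && ((Pplus (F n))%:R <= y)]|.

(* Main.v *)
Require Import Defs.
From HB Require Import structures.
From mathcomp Require Import all_boot all_order all_algebra all_field.
From mathcomp Require Import all_classical all_reals all_analysis.
From mathcomp Require Import zify ring lra.

Import Order.TTheory GRing.Theory Num.Theory.
Import numFieldNormedType.Exports.

(** Weigh each prime power dividing some [n^2 + 1], [n <= N], by [ln p]: the
    total weight is [2 N ln N + O(N)].  For [p <= N] there are
    [(1 + chi4 p) N / p + O(1)] integers [n <= N] with [p | n^2 + 1], so by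
    Mertens' theorem for the residue class 1 modulo 4 the primes [p <= N]
    account for at least [N ln N - O(N)] of it.  Hence the primes above [N]
    weigh at most [N ln N + O(N)], while every [n] with [P^+(n^2 + 1) > y > N]
    contributes at least [ln y]; at most [u x + O(x / ln x)] such [n] exist.

    Mertens' theorem for [chi4] follows from writing [ln] as a sum over prime
    powers in [\sum_(n <= N) chi4 n ln n / n], which is bounded, because the
    partial sums of [L(1, chi4)] stay at least [1/2] and converge at rate
    [1/t]. *)

(** * Chebyshev's upper bound through primorials *)

Lemma prod_distinct_primes_dvdn (s : seq nat) (K : nat) :
  uniq s -> (forall p, p \in s -> prime p /\ p %| K) -> \prod_(p <- s) p %| K.
Proof.
elim: s => [|p s IH] /=; first by rewrite big_nil dvd1n.
move=> /andP[ps us] h; rewrite big_cons.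
have [pp pK] := h p (mem_head _ _).
have hs q : q \in s -> prime q /\ q %| K by move=> qs; apply: h; rewrite inE qs orbT.
rewrite Gauss_dvd ?pK ?IH //.
rewrite prime_coprime // Euclid_dvd_prod //.
rewrite big_has; apply/hasPn => q qs; have [pq _] := hs q qs.
rewrite dvdn_prime2 //.
by apply: contraNneq ps => ->.
Qed.

Lemma prime_dvdn_fact (p n : nat) : prime p -> (p %| n`!) = (p <= n).
Proof.
move=> pp; elim: n => [|n IH].
  by rewrite fact0 Euclid_dvd1 //; have := prime_gt0 pp; lia.
rewrite factS Euclid_dvdM // IH; apply/orP/idP => [[/dvdn_leq|]|]; try lia.
by rewrite leq_eqVlt => /predU1P [->|]; [left|right].
Qed.

(** The two equal middle entries of row [2m + 1] of Pascal's triangle add up to at most the whole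
    row, [2 ^ (2m + 1) = 2 * 4 ^ m]. *)
Lemma bin_central_odd_le (m : nat) : 'C(m.*2.+1, m) <= 4 ^ m.
Proof.
suff: 'C(m.*2.+1, m) * 2 <= 4 ^ m * 2 by rewrite leq_pmul2r.
have -> : 4 ^ m * 2 = 2 ^ m.*2.+1 by rewrite expnS -muln2 mulnC (mulnC m) expnM.
have -> : 2 ^ m.*2.+1 = \sum_(0 <= i < m.*2.+2) 'C(m.*2.+1, i).
  rewrite -[2]/(1 + 1) expnDn big_mkord.
  by apply: eq_bigr => i _; rewrite !exp1n !muln1.
rewrite (@big_cat_nat _ _ _ m) /=; [|lia|lia].
rewrite (@big_ltn _ _ _ m) /=; last by lia.
rewrite (@big_ltn _ _ _ m.+1) /=; last by lia.
have -> : 'C(m.*2.+1, m.+1) = 'C(m.*2.+1, m).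
  by rewrite -bin_sub; [congr 'C(_, _)|]; lia.
lia.
Qed.

(** Erdős's strong induction. For [n = 2m + 1] the induction hypothesis handles the primes up to
    [m + 1], and the product of the primes in [[m + 2, 2m + 1]] divides ['C(2m + 1, m)], hence is at
    most [4 ^ m]. *)
Lemma primorial_le (n : nat) : \prod_(0 <= p < n.+1 | prime p) p <= 4 ^ n.
Proof.
elim/ltn_ind: n => n IH.
case: (leqP n 2) => [|n2].
  by case: n {IH} => [|[|[|//]]] _; rewrite unlock.
have nE := odd_double_half n.
case: (boolP (odd n)) => on; rewrite ?on ?(negPf on) in nE; last first.
  (* An even [n > 2] is not prime, so the bound for [n - 1] suffices. *)
  rewrite big_mkcond big_nat_recr //= -big_mkcond /= ifN; last first.
    by apply/negP => /even_prime [|]; [lia|rewrite (negPf on)].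
  have -> : n = n.-1.+1 by lia.
  by rewrite muln1 (leq_trans (IH n.-1 _)) ?leq_pexp2l //; lia.
set m := n./2 in nE.
rewrite (@big_cat_nat _ _ _ m.+2) //=; last by lia.
have -> : n = m.+1 + m by lia.
rewrite expnD leq_mul ?IH //; first by lia.
apply: leq_trans (bin_central_odd_le m).
apply: dvdn_leq; first by rewrite bin_gt0; lia.
rewrite -big_filter; apply: prod_distinct_primes_dvdn.
  by rewrite filter_uniq ?iota_uniq.
move=> p; rewrite mem_filter mem_index_iota => /andP[pp /andP[lo hi]]; split=> //.
(* [p] divides [(2m + 1)!] but neither [m!] nor [(m + 1)!], since [p > m + 1]; so it divides the
   binomial coefficient. *)
have h := @bin_fact m.*2.+1 m ltac:(lia).
have : p %| m.*2.+1`! by apply: dvdn_fact; lia.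
rewrite -h Euclid_dvdM // => /orP[//|].
rewrite Euclid_dvdM // !prime_dvdn_fact //; lia.
Qed.

(** * Square roots of -1 modulo a prime, and multiples of [p] among the [n ^ 2 + 1] *)

Lemma sqrtN1_mod_prime (p : nat) : prime p -> p %% 4 = 1 ->
  exists a, 0 < a < p /\ p %| a ^ 2 + 1.
Proof.
move=> pp p1; have p0 := prime_gt1 pp.
pose k := p %/ 4; have pE : p = 4 * k + 1 by rewrite /k; lia.
have cF : #|'F_p| = p by rewrite card_Fp.
(* The polynomial [X^(2k) - 1] has at most [2k] roots, fewer than the [4k] nonzero residues. For a
   nonzero non-root [x], the square of [x^(2k)] is 1, so [x^(2k) = -1] and [x^k] is the required
   square root. *)
have [x x0 hx] : exists2 x : 'F_p, (x != 0)%R & (x ^+ (2 * k) != 1)%R.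
  apply/exists_inP; apply: contraT => /exists_inPn h.
  pose q : {poly 'F_p} := ('X^(2 * k) - 1%:P)%R.
  have sq : size q = (2 * k).+1 by rewrite /q size_XnsubC //; lia.
  have q0 : q != 0%R by rewrite -size_poly_gt0 sq.
  pose s := [seq x <- enum 'F_p | x != 0%R].
  have : size s < size q.
    apply: max_poly_roots => //.
      apply/allP => x; rewrite mem_filter => /andP[x0 _].
      rewrite rootE /q !hornerE ?hornerXn subr_eq0; apply: negbNE; exact: h.
    by rewrite filter_uniq ?enum_uniq.
  have -> : size s = p.-1.
    rewrite /s size_filter -sum1_count big_enum_cond /= sum1_card.
    by have := cardC1 (0%R : 'F_p); rewrite cF => <-; apply: eq_card => y; rewrite !inE ?andbT.
  rewrite sq; lia.
have x4 : (x ^+ (4 * k) = 1)%R.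
  have := expf_card x; rewrite cF [X in (_ ^+ X)%R]pE exprD expr1 => h.
  by apply: (mulIf x0); rewrite mul1r.
have xk : ((x ^+ k) ^+ 2 = -1)%R.
  have : ((x ^+ (2 * k)) ^+ 2 == 1)%R by rewrite -exprM mulnC mulnA x4.
  rewrite sqrf_eq1 (negPf hx) /= => /eqP <-; by rewrite -exprM mulnC.
pose a := val (x ^+ k)%R.
have ap : a < p by have := ltn_ord (x ^+ k)%R; rewrite [X in _ < X]Fp_cast.
have aE : (a%:R = x ^+ k :> 'F_p)%R by rewrite /a natr_Zp.
exists a; split.
  rewrite ap andbT lt0n; apply: contra_eqN xk => /eqP a0.
  by rewrite -aE a0 expr2 mul0r eq_sym oppr_eq0 oner_eq0.
rewrite (dvdn_pcharf (pchar_Fp pp)) natrD natrX aE xk addNr //.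
Qed.

Definition sqp1_count (p N : nat) : nat := \sum_(1 <= n < N.+1) (p %| n ^ 2 + 1).

(** Divisibility of [n ^ 2 + 1] by [p] is periodic in [n], so each of the [N %/ p] complete blocks
    of length [p] contributes at least [c]. *)
Lemma sqp1_count_blocks (p c N : nat) : 0 < p ->
  c <= \sum_(0 <= n < p) (p %| n ^ 2 + 1) -> N %/ p * c <= sqp1_count p N.
Proof.
move=> p0 hc; have [p1|p1] := eqVneq p 1.
  rewrite p1 divn1 in hc *; rewrite /sqp1_count (eq_bigr (fun=> 1)) => [|i _].
    by rewrite big_nat1 dvd1n in hc; rewrite sum_nat_const_nat; nia.
  by rewrite dvd1n.
have periodic q : \sum_(q * p <= n < q.+1 * p) (p %| n ^ 2 + 1) =
    \sum_(0 <= n < p) (p %| n ^ 2 + 1).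
  rewrite -{1}(add0n (q * p)) big_addn mulSn addnK; apply: eq_bigr => i _; congr nat_of_bool.
  have -> : (i + q * p) ^ 2 + 1 = (2 * i * q + q ^ 2 * p) * p + (i ^ 2 + 1) by ring.
  by rewrite dvdn_addr // dvdn_mull.
have le q : q * c <= \sum_(0 <= n < q * p) (p %| n ^ 2 + 1).
  elim: q => // q IH; rewrite (@big_cat_nat _ _ _ (q * p)) //=.
    by rewrite periodic mulSn addnC leq_add.
  by rewrite leq_mul2r leqnSn orbT.
apply: leq_trans (le _) _.
have h : N %/ p * p <= N.+1 by rewrite leqW // leq_divM.
apply: (@leq_trans (\sum_(0 <= n < N.+1) (p %| n ^ 2 + 1))).
  by rewrite [X in _ <= X](@big_cat_nat _ _ _ (N %/ p * p)) //= leq_addr.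
(* The blocks start at [n = 0] but [sqp1_count] starts at [n = 1]; the extra term is zero because
   [p != 1]. *)
by rewrite big_ltn //= exp0n // dvdn1 (negPf p1).
Qed.

(** The residues [a] and [p - a] are two solutions, distinct because [p] is odd. *)
Lemma sqp1_count_1mod4 (p N : nat) : prime p -> p %% 4 = 1 ->
  N %/ p * 2 <= sqp1_count p N.
Proof.
move=> pp p1; apply: sqp1_count_blocks; first exact: prime_gt0.
have [a [/andP[a0 ap] ha]] := sqrtN1_mod_prime p pp p1.
rewrite big_mkord (bigD1 (Ordinal ap)) //=.
have bp : p - a < p by lia.
rewrite (bigD1 (Ordinal bp)) /=; last by apply/eqP => -[]; lia.
(* The congruence of [(p - a) ^ 2] and [a ^ 2] modulo [p], with the cross term moved to the left to
   stay within natural numbers. *)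
have e : 2 * a * p + ((p - a) ^ 2 + 1) = p * p + (a ^ 2 + 1).
  have := subnKC (ltnW ap); set b := p - a => <-; ring.
have hb : p %| (p - a) ^ 2 + 1.
  by rewrite -(dvdn_addr _ (dvdn_mull (2 * a) (dvdnn p))) e dvdn_add // dvdn_mulr.
by rewrite ha hb addnA leq_addr.
Qed.

Lemma sqp1_count_2 (N : nat) : N %/ 2 <= sqp1_count 2 N.
Proof.
rewrite -[N %/ 2]muln1; apply: sqp1_count_blocks => //.
by rewrite unlock.
Qed.

(** * Logarithm estimates and summation by parts *)

Local Open Scope classical_set_scope.
Local Open Scope ring_scope.

Lemma ln_prod (R : realType) (I : Type) (s : seq I) (P : pred I) (f : I -> R) :
  (forall i, P i -> 0 < f i) ->
  ln (\prod_(i <- s | P i) f i) = \sum_(i <- s | P i) ln (f i).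
Proof.
move=> f0; suff [] : 0 < \prod_(i <- s | P i) f i /\
  ln (\prod_(i <- s | P i) f i) = \sum_(i <- s | P i) ln (f i) by [].
apply: (big_ind2 (fun x y => 0 < x /\ ln x = y)).
- by rewrite ln1.
- by move=> x1 y1 x2 y2 [? <-] [? <-]; rewrite mulr_gt0 // lnM.
- by move=> i /f0.
Qed.

Lemma lnn_ge0 (R : realType) (n : nat) : 0 <= ln (n%:R : R).
Proof.
case: n => [|n]; first by rewrite ln0.
by rewrite ln_ge0 // ler1n.
Qed.

Lemma ln_natS_sub_le (R : realType) (n : nat) :
  n%:R * (ln n.+1%:R - ln n%:R) <= 1 :> R.
Proof.
case: n => [|n]; first by rewrite mul0r.
have n0 : 0 < n.+1%:R :> R by rewrite ltr0n.
rewrite -ln_div ?posrE ?ltr0n // -ler_pdivlMl // mulr1.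
have -> : n.+2%:R / n.+1%:R = 1 + n.+1%:R^-1 :> R.
  by rewrite -natr1 mulrDl divff ?gt_eqF // mul1r.
apply: le_ln1Dx; apply: (@lt_trans _ _ 0); rewrite ?invr_gt0 ?ltrN10 //.
Qed.

(* Unlike [ln n / n], this sequence is nonincreasing from [n = 1] on. *)
Definition lnp1_over (R : realType) (n : nat) : R := (ln n%:R + 1) / n%:R.

(** Over the common denominator the difference has numerator [ln n + 1 - n (ln (n + 1) - ln n)],
    which is at least [ln n]. This bounds the sum of [ln n / (n (n + 1))] by telescoping. *)
Lemma lnp1_over_sub (R : realType) (n : nat) : (0 < n)%N ->
  ln n%:R / (n%:R * n.+1%:R) <= lnp1_over R n - lnp1_over R n.+1.
Proof.
move=> n0; have h := ln_natS_sub_le R n.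
have n0' : 0 < n%:R :> R by rewrite ltr0n.
rewrite /lnp1_over; move: h; rewrite -natr1.
set a := ln n%:R; set b := ln _; set m : R := n%:R in n0' * => h.
have m1 : 0 < m + 1 by lra.
have -> : (a + 1) / m - (b + 1) / (m + 1) = ((a + 1) * (m + 1) - (b + 1) * m) / (m * (m + 1)).
  by field; rewrite !gt_eqF.
rewrite ler_pM2r ?invr_gt0 ?mulr_gt0 //; lra.
Qed.

Lemma lnp1_over_ge0 (R : realType) (n : nat) : 0 <= lnp1_over R n.
Proof. by rewrite divr_ge0 // addr_ge0 // lnn_ge0. Qed.

Lemma lnp1_over_noninc (R : realType) (n : nat) : (0 < n)%N ->
  lnp1_over R n.+1 <= lnp1_over R n.
Proof.
move=> n0; rewrite -subr_ge0; apply: le_trans (lnp1_over_sub R n n0).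
by rewrite divr_ge0 ?mulr_ge0 ?lnn_ge0.
Qed.

Lemma sum_ln_over_sqr_le (R : realType) (N : nat) :
  \sum_(1 <= n < N.+1) ln n%:R / (n%:R * n.+1%:R) <= 1 :> R.
Proof.
suff : \sum_(1 <= n < N.+1) ln n%:R / (n%:R * n.+1%:R) <= 1 - lnp1_over R N.+1.
  by move/le_trans; apply; rewrite gerBl lnp1_over_ge0.
elim: N => [|N IH].
  by rewrite big_geq // /lnp1_over ln1 add0r divr1 subrr.
rewrite big_nat_recr //=.
by apply: le_trans (lerD IH (lnp1_over_sub R N.+1 isT)) _; rewrite addrA subrK.
Qed.

Lemma sum_geo_from2_le (R : realType) (x : R) (K : nat) : 0 <= x -> x <= 2^-1 ->
  \sum_(2 <= k < K) x ^+ k <= 2 * x ^+ 2.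
Proof.
move=> x0 x2; have [K2|K2] := leqP K 2.
  by rewrite big_geq // mulr_ge0 // exprn_ge0.
(* The subtracted term carries the induction: [x <= 1/2] gives
   [x ^ K <= 2 x ^ K - 2 x ^ (K + 1)]. *)
suff : \sum_(2 <= k < K) x ^+ k <= 2 * x ^+ 2 - 2 * x ^+ K.
  by have : 0 <= x ^+ K by [rewrite exprn_ge0]; lra.
elim: K K2 => // K IH; rewrite ltnS leq_eqVlt => /predU1P [<-|K2].
  by rewrite big_nat1 !exprS expr0; nra.
have {}IH := IH K2; rewrite (big_nat_recr _ _ _ (ltnW K2)) /=.
have : 0 <= x ^+ K * (1 - 2 * x) by rewrite mulr_ge0 ?exprn_ge0 //; lra.
rewrite (exprS x K); move: IH; set S := \sum_(_ <= _ < _) _; set y := x ^+ K.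
lra.
Qed.

(** Proper prime powers contribute only [O(1)]. The geometric sum over [k >= 2] is at most
    [2 / p ^ 2], and [p >= 2] makes this at most [3 / (p (p + 1))], whose sum against [ln p] is
    controlled by telescoping. *)
Lemma sum_higher_powers_le (R : realType) (N : nat) (G : nat -> R) :
  (forall d, (0 < d)%N -> `|G d| <= d%:R^-1) ->
  `|\sum_(1 <= p < N.+1 | prime p) ln p%:R * \sum_(2 <= k < N.+1) G (p ^ k)%N| <= 3.
Proof.
move=> hG.
apply: (@le_trans _ _ (\sum_(1 <= p < N.+1) 3 * (ln p%:R / (p%:R * p.+1%:R)))); last first.
  by rewrite -mulr_sumr -[X in _ <= X]mulr1 ler_wpM2l // sum_ln_over_sqr_le.
rewrite big_mkcond /=; apply: le_trans (ler_norm_sum _ _ _) _.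
apply: ler_sum_nat => p /andP[p0 _]; case: ifP => [pp|_]; last first.
  by rewrite normr0 mulr_ge0 // divr_ge0 ?lnn_ge0.
rewrite normrM (ger0_norm (lnn_ge0 _ _)) mulrCA ler_wpM2l ?lnn_ge0 //.
apply: le_trans (ler_norm_sum _ _ _) _.
apply: (@le_trans _ _ (\sum_(2 <= k < N.+1) (p%:R^-1 : R) ^+ k)).
  by apply: ler_sum => k _; rewrite (le_trans (hG _ _)) ?expn_gt0 ?p0 // natrX exprVn.
have p2 : 2 <= p%:R :> R by rewrite ler_nat prime_gt1.
have p0' : 0 < p%:R :> R by lra.
apply: le_trans (sum_geo_from2_le _ _ _ _ _) _.
- by rewrite invr_ge0 ltW.
- by rewrite lef_pV2 ?posrE.
rewrite -[p.+1%:R]natr1 exprVn -subr_ge0.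
have -> : 3 / (p%:R * (p%:R + 1)) - 2 / p%:R ^+ 2 = (p%:R - 2) / (p%:R ^+ 2 * (p%:R + 1)) :> R.
  by field; rewrite !gt_eqF //; lra.
by rewrite divr_ge0 ?mulr_ge0 ?exprn_ge0 //; lra.
Qed.

Lemma abel_bound (R : realType) (c g : nat -> R) (a b : nat) : (a <= b)%N ->
  (forall j, `|\sum_(a <= n < j) c n| <= 1) ->
  (forall n, (a <= n)%N -> 0 <= g n) ->
  (forall n, (a <= n)%N -> g n.+1 <= g n) ->
  `|\sum_(a <= n < b) c n * g n| <= g a.
Proof.
move=> ab hc g0 gd; pose C j := \sum_(a <= n < j) c n.
(* Without its boundary term, the sum by parts consists of the terms [C n.+1 * (g n - g n.+1)],
   bounded by a telescoping sum. *)
have h : `|\sum_(a <= n < b) c n * g n - C b * g b| <= g a - g b.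
  elim: b ab => [|b IH].
    by rewrite leqn0 => /eqP ->; rewrite /C !big_geq // mul0r !subrr normr0.
  rewrite leq_eqVlt => /predU1P [<-|ab]; first by rewrite /C !big_geq // mul0r !subrr normr0.
  have {}IH := IH ab.
  have -> : \sum_(a <= n < b.+1) c n * g n - C b.+1 * g b.+1 =
    (\sum_(a <= n < b) c n * g n - C b * g b) + C b.+1 * (g b - g b.+1).
    by rewrite /C !big_nat_recr //=; ring.
  apply: le_trans (ler_normD _ _) _.
  have := gd b ab; rewrite normrM; have := hc b.+1; rewrite -/(C _) => h1 h2.
  rewrite (ger0_norm (x := g b - _)) ?subr_ge0 //; nra.
have h2 : `|C b * g b| <= g b.
  by rewrite normrM (ger0_norm (g0 b ab)) -[X in _ <= X]mul1r ler_wpM2r ?g0 ?hc.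
rewrite -[X in `|X|](subrK (C b * g b)).
apply: le_trans (ler_normD _ _) _; lra.
Qed.

(** * The nonprincipal character modulo 4 and the partial sums of [L(1, chi4)] *)

Definition chi4 (R : realType) (n : nat) : R :=
  (n %% 4 == 1)%N%:R - (n %% 4 == 3)%N%:R.

Lemma chi4M (R : realType) (m n : nat) : chi4 R (m * n) = chi4 R m * chi4 R n.
Proof.
rewrite /chi4 -modnMm.
move: (m %% 4)%N (n %% 4)%N (ltn_pmod m (isT : 0 < 4)%N) (ltn_pmod n (isT : 0 < 4)%N).
move=> a b; case: a => [|[|[|[|//]]]] _; case: b => [|[|[|[|//]]]] _;
  rewrite /= ?(subr0, sub0r, mulr0, mul0r, mulr1, mul1r, mulrNN) //.
Qed.

Lemma sum_chi4 (R : realType) (n : nat) :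
  \sum_(0 <= k < n) chi4 R k = (1 < n %% 4)%N%:R.
Proof.
elim: n => [|n IH]; first by rewrite big_geq.
rewrite big_nat_recr //= IH /chi4 -[n.+1]addn1 -modnDml.
by move: (n %% 4)%N (ltn_pmod n (isT : 0 < 4)%N) => [|[|[|[|//]]]] _ /=;
  rewrite ?(subr0, sub0r, addr0, add0r, addrN).
Qed.

Lemma sum_chi4_norm_le1 (R : realType) (a b : nat) : `|\sum_(a <= k < b) chi4 R k| <= 1.
Proof.
have [ab|ab] := leqP a b; last by rewrite big_geq ?normr0 // ltnW.
have -> : \sum_(a <= k < b) chi4 R k = (1 < b %% 4)%N%:R - (1 < a %% 4)%N%:R.
  by rewrite -!sum_chi4 (@big_cat_nat _ _ _ a 0 b) //= addrAC subrr add0r.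
by case: (1 < _)%N; case: (1 < _)%N; rewrite /= ?subrr ?subr0 ?sub0r ?normrN ?normr0 ?normr1.
Qed.

Lemma chi4_norm_le1 (R : realType) (n : nat) : `|chi4 R n| <= 1.
Proof. by have := sum_chi4_norm_le1 R n n.+1; rewrite big_nat1. Qed.

Definition L4 (R : realType) (t : nat) : R := \sum_(1 <= k < t.+1) chi4 R k / k%:R.

Lemma L4_tail_le (R : realType) (a b : nat) : (0 < a)%N -> (a <= b)%N ->
  `|\sum_(a <= k < b) chi4 R k / k%:R| <= a%:R^-1.
Proof.
move=> a0 ab; apply: (abel_bound _ _ (fun n => n%:R^-1)) => // [j|n an].
  exact: sum_chi4_norm_le1.
by rewrite lef_pV2 ?posrE ?ltr0n ?ler_nat //; apply: leq_trans an.
Qed.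

Lemma L4_norm_le1 (R : realType) (t : nat) : `|L4 R t| <= 1.
Proof. by have := L4_tail_le R 1 t.+1 isT isT; rewrite invr1. Qed.

(** The first term is 1, and the tail from [k = 2] is at most [1/2] in absolute value. *)
Lemma L4_ge (R : realType) (t : nat) : (0 < t)%N -> 2^-1 <= L4 R t.
Proof.
move=> t0; rewrite /L4 big_ltn // /chi4 /= subr0 divr1.
have := L4_tail_le R 2 t.+1 isT t0; rewrite ler_norml => /andP[h _].
by rewrite -/(chi4 R); lra.
Qed.

(** The difference is a tail of the series starting just above [N / m]. It serves to replace
    [L4 (N %/ p)] by the common factor [L4 N]. *)
Lemma L4_sub_le (R : realType) (N m : nat) : (0 < m)%N ->
  `|L4 R (N %/ m) - L4 R N| <= m%:R / N%:R.
Proof.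
move=> m0; case: N => [|N]; first by rewrite div0n subrr normr0 invr0 mulr0.
rewrite distrC /L4 (@big_cat_nat _ _ _ (N.+1 %/ m).+1 _ N.+2) //=; last by rewrite ltnS leq_div.
rewrite addrAC subrr add0r.
apply: le_trans (L4_tail_le _ _ _ _ _) _; rewrite ?ltnS ?leq_div //.
rewrite -[m%:R / _]invf_div lef_pV2 ?posrE ?divr_gt0 ?ltr0n //.
rewrite ler_pdivrMr ?ltr0n // -natrM ler_nat; apply: ltnW; exact: ltn_ceil.
Qed.

(** * Expanding logarithms over prime powers *)

Lemma ln_sum_logn (R : realType) (n M : nat) : (0 < n)%N -> (n <= M)%N ->
  ln n%:R = \sum_(1 <= p < M.+1 | prime p) (logn p n)%:R * ln p%:R :> R.
Proof.
move=> n0 nM; rewrite -{1}(partnT n0) (widen_partn _ nM) natr_prod ln_prod => [|p _]; last first.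
  by rewrite ltr0n expn_gt0; case: p => [|p] //; rewrite [logn 0 n]lognE.
rewrite big_ltn //= [X in X + _](_ : _ = 0) ?add0r; last by rewrite lognE /= ln1.
rewrite [RHS]big_mkcond; apply: eq_big_nat => p /andP[p0 _].
case: ifP => pp; last by rewrite lognE pp expn0 ln1.
by rewrite natrX lnXn ?ltr0n // mulr_natl.
Qed.

(** A range for [k] independent of [n] allows sums to be exchanged; the added terms vanish because
    [p ^ k > n]. *)
Lemma logn_sum_dvd (p n M : nat) : prime p -> (0 < n)%N -> (n <= M)%N ->
  logn p n = (\sum_(1 <= k < M.+1) (p ^ k %| n))%N.
Proof.
move=> pp n0 nM; rewrite logn_count_dvd // [RHS](@big_cat_nat _ _ _ n) //=; last exact: leqW.
rewrite [X in (_ + X)%N]big_nat_cond [X in (_ + X)%N]big1 ?addn0 // => k /andP[/andP[nk _] _].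
rewrite gtnNdvd //; apply: leq_ltn_trans nk _; exact: ltn_expl (prime_gt1 pp).
Qed.

Lemma sum_multiples (R : realType) (d N : nat) (f : nat -> R) : (0 < d)%N ->
  \sum_(1 <= n < N.+1) (d %| n)%N%:R * f n = \sum_(1 <= m < (N %/ d).+1) f (d * m)%N.
Proof.
move=> d0; elim: N => [|N IH]; first by rewrite div0n !big_geq.
rewrite big_nat_recr //= IH divnS //.
case: (boolP (d %| N.+1)%N) => h; last by rewrite add0n mul0r addr0.
rewrite add1n [RHS]big_nat_recr //= mul1r; congr (_ + f _).
by have := divnK h; rewrite divnS // h add1n mulnC.
Qed.

(** Expand [ln n] over the prime powers dividing [n] and exchange sums: [G d] collects [f] over the
    multiples of [d]. The primes are kept apart from the powers with [k >= 2], which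
    [sum_higher_powers_le] bounds. *)
Lemma sum_ln_swap (R : realType) (N : nat) (f : nat -> R) :
  let G d := \sum_(1 <= m < (N %/ d).+1) f (d * m)%N in
  \sum_(1 <= n < N.+1) f n * ln n%:R =
  \sum_(1 <= p < N.+1 | prime p) ln p%:R * G p +
  \sum_(1 <= p < N.+1 | prime p) ln p%:R * \sum_(2 <= k < N.+1) G (p ^ k)%N.
Proof.
move=> G; case: N @G => [|N] G; first by rewrite !big_geq // addr0.
rewrite -big_split /=.
transitivity (\sum_(1 <= n < N.+2) \sum_(1 <= p < N.+2 | prime p)
   ln p%:R * \sum_(1 <= k < N.+2) (p ^ k %| n)%N%:R * f n).
  apply: eq_big_nat => n /andP[n0 nN].
  rewrite (@ln_sum_logn R n N.+1) // mulr_sumr; apply: eq_bigr => p pp.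
  rewrite (@logn_sum_dvd p n N.+1) // natr_sum -mulr_suml; ring.
rewrite exchange_big /=; apply: eq_bigr => p pp.
rewrite -mulr_sumr -mulrDr; congr (_ * _); rewrite exchange_big /=.
rewrite big_ltn //; congr (_ + _).
  by rewrite expn1 sum_multiples // prime_gt0.
by apply: eq_bigr => k _; rewrite sum_multiples // expn_gt0 prime_gt0.
Qed.

(** * Chebyshev and Mertens estimates, plain and twisted by [chi4] *)

Lemma theta_le (R : realType) (N : nat) :
  \sum_(1 <= p < N.+1 | prime p) ln p%:R <= N%:R * ln 4 :> R.
Proof.
have e : \sum_(1 <= p < N.+1 | prime p) ln p%:R =
    ln (\prod_(0 <= p < N.+1 | prime p) p)%N%:R :> R.
  rewrite natr_prod ln_prod => [|p pp]; last by rewrite ltr0n prime_gt0.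
  by rewrite [RHS]big_ltn_cond.
have -> : N%:R * ln 4 = ln (4 ^ N)%N%:R :> R by rewrite natrX lnXn ?ltr0n // mulr_natl.
rewrite e ler_ln ?posrE ?ltr0n ?expn_gt0 //.
  by rewrite ler_nat primorial_le.
by rewrite prodn_cond_gt0 // => p /prime_gt0.
Qed.

Lemma sum_ln_ge (R : realType) (N : nat) :
  N%:R * ln N%:R - N%:R <= \sum_(1 <= n < N.+1) ln n%:R :> R.
Proof.
elim: N => [|N IH]; first by rewrite big_geq // mul0r subr0.
rewrite big_nat_recr //=; have := ln_natS_sub_le R N; move: IH.
move: (ln N.+1%:R) (ln N%:R) (\sum_(_ <= _ < _) _) => a b c; rewrite -natr1; lra.
Qed.

(** Take the constant weight [1/N] in [sum_ln_swap], so [0 <= G d <= 1/d]. The loss 4 is 1 from the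
    Stirling-type bound [sum_ln_ge] plus 3 from higher powers. *)
Lemma mertens_ge (R : realType) (N : nat) : (0 < N)%N ->
  ln N%:R - 4 <= \sum_(1 <= p < N.+1 | prime p) ln p%:R / p%:R :> R.
Proof.
move=> N0; have N0' : 0 < N%:R :> R by rewrite ltr0n.
have := sum_ln_swap R N (fun=> N%:R^-1); cbv zeta beta => e.
have hG d : (0 < d)%N -> `|\sum_(1 <= m < (N %/ d).+1) N%:R^-1| <= d%:R^-1 :> R.
  move=> d0; rewrite sumr_const_nat subn1 /= ger0_norm ?mulrn_wge0 ?invr_ge0 //.
  rewrite -[_ *+ (N %/ d)]mulr_natl ler_pdivrMr // ler_pdivlMl ?ltr0n // -natrM ler_nat mulnC.
  exact: leq_divM.
have h2 := sum_higher_powers_le R N _ hG; rewrite ler_norml in h2.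
have h1 : \sum_(1 <= p < N.+1 | prime p) ln p%:R * \sum_(1 <= m < (N %/ p).+1) N%:R^-1 <=
   \sum_(1 <= p < N.+1 | prime p) ln p%:R / p%:R :> R.
  apply: ler_sum => p pp; rewrite ler_wpM2l ?lnn_ge0 // (le_trans (ler_norm _)) ?hG //.
  exact: prime_gt0.
have h3 : ln N%:R - 1 <= \sum_(1 <= n < N.+1) N%:R^-1 * ln n%:R :> R.
  rewrite -mulr_sumr ler_pdivlMl //; have := sum_ln_ge R N.
  by rewrite mulrBr mulr1.
rewrite e in h3; case/andP: h2 => _ h2; move: (le_trans h3 (lerD h1 h2)).
by move: (ln N%:R) (\sum_(_ <= _ < _ | _) _) => a b; lra.
Qed.

(** Write [ln n / n] as the monotone [lnp1_over n] minus [1/n]; each of the two twisted sums is at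
    most 1. *)
Lemma sum_chi4_ln_le (R : realType) (N : nat) :
  `|\sum_(1 <= n < N.+1) chi4 R n / n%:R * ln n%:R| <= 2.
Proof.
have -> : \sum_(1 <= n < N.+1) chi4 R n / n%:R * ln n%:R =
   \sum_(1 <= n < N.+1) chi4 R n * lnp1_over R n - L4 R N.
  rewrite -sumrB; apply: eq_bigr => n _; rewrite /lnp1_over.
  by rewrite mulrA mulrDr mulr1 mulrDl addrK mulrAC.
have h : `|\sum_(1 <= n < N.+1) chi4 R n * lnp1_over R n| <= 1.
  have -> : 1 = lnp1_over R 1 by rewrite /lnp1_over ln1 add0r divr1.
  apply: abel_bound => // [j|n _|n n1]; first exact: sum_chi4_norm_le1.
    exact: lnp1_over_ge0.
  exact: lnp1_over_noninc.
apply: le_trans (ler_normB _ _) _; have := L4_norm_le1 R N.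
move: h; move: `|_| `|_| => a b; lra.
Qed.

Lemma ln4_le (R : realType) : ln 4 <= 4 :> R.
Proof. by rewrite ltW // ln_sublinear // ltr0n. Qed.

(** By multiplicativity [G d = chi4 d / d * L4 (N %/ d)]. Passing to [L4 N] costs at most
    [theta(N) / N <= 4], so [L4 N] times the sum is at most [2 + 3 + 4 = 9] in absolute value;
    [L4 N >= 1/2] then gives 18. *)
Lemma mertens_chi4_ge (R : realType) (N : nat) : (0 < N)%N ->
  - 18 <= \sum_(1 <= p < N.+1 | prime p) chi4 R p * ln p%:R / p%:R :> R.
Proof.
move=> N0; have N0' : 0 < N%:R :> R by rewrite ltr0n.
have GE d : (0 < d)%N -> \sum_(1 <= m < (N %/ d).+1) chi4 R (d * m) / (d * m)%N%:R =
    chi4 R d / d%:R * L4 R (N %/ d).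
  move=> d0; rewrite mulr_sumr; apply: eq_bigr => m _.
  by rewrite chi4M natrM invfM mulrACA.
have hG d : (0 < d)%N ->
    `|\sum_(1 <= m < (N %/ d).+1) chi4 R (d * m) / (d * m)%N%:R| <= d%:R^-1.
  move=> d0; rewrite GE // !normrM normfV (ger0_norm (x := d%:R)) //.
  rewrite mulrAC -[X in _ <= X]mul1r ler_wpM2r ?invr_ge0 //.
  by rewrite -[X in _ <= X]mulr1 ler_pM // ?chi4_norm_le1 ?L4_norm_le1.
have h2 := sum_higher_powers_le R N _ hG.
have := sum_ln_swap R N (fun n => chi4 R n / n%:R); cbv zeta beta => e.
have h3 := sum_chi4_ln_le R N; rewrite e in h3.
set X := \sum_(1 <= p < N.+1 | prime p) _.
have E1 : \sum_(1 <= p < N.+1 | prime p) ln p%:R *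
      (\sum_(1 <= m < (N %/ p).+1) chi4 R (p * m) / (p * m)%N%:R) =
    L4 R N * X + \sum_(1 <= p < N.+1 | prime p)
      chi4 R p * ln p%:R / p%:R * (L4 R (N %/ p) - L4 R N).
  rewrite /X mulr_sumr -big_split /=; apply: eq_bigr => p pp.
  by rewrite GE ?prime_gt0 //; ring.
have E2 : `|\sum_(1 <= p < N.+1 | prime p)
      chi4 R p * ln p%:R / p%:R * (L4 R (N %/ p) - L4 R N)| <= 4.
  apply: le_trans (ler_norm_sum _ _ _) _.
  apply: (@le_trans _ _ (\sum_(1 <= p < N.+1 | prime p) ln p%:R / N%:R)); last first.
    rewrite -mulr_suml ler_pdivrMr // (le_trans (theta_le _ _)) // mulrC ler_wpM2r //.
    exact: ln4_le.
  apply: ler_sum => p pp; have p0 := prime_gt0 pp.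
  have p0' : 0 < p%:R :> R by rewrite ltr0n.
  rewrite !normrM normfV (ger0_norm (x := p%:R)) // (ger0_norm (lnn_ge0 _ _)).
  have -> : ln p%:R / N%:R = 1 * ln p%:R / p%:R * (p%:R / N%:R) :> R.
    by field; rewrite !gt_eqF.
  rewrite ler_pM // ?L4_sub_le ?mulr_ge0 ?invr_ge0 ?lnn_ge0 //.
  by rewrite !ler_wpM2r ?invr_ge0 ?lnn_ge0 // chi4_norm_le1.
have L0 := L4_ge R N N0.
have L1 : `|L4 R N * X| <= 9.
  rewrite E1 in h3; move: h3 h2 E2; rewrite !ler_norml.
  move: (L4 R N * X) => a; move: (\sum_(_ <= _ < _ | _) _) => b.
  move: (\sum_(_ <= _ < _ | _) _) => c.
  by move=> /andP[? ?] /andP[? ?] /andP[? ?]; apply/andP; split; lra.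
move: L1; rewrite ler_norml => /andP[L1 _].
rewrite leNgt; apply/negP => hX; move: L1; rewrite leNgt => /negP; apply.
clear -L0 hX; move: (L4 R N) X L0 hX => a b; nra.
Qed.

Lemma mertens_1_plus_chi4_ge (R : realType) (N : nat) : (0 < N)%N ->
  ln N%:R - 22 <= \sum_(1 <= p < N.+1 | prime p) (1 + chi4 R p) * ln p%:R / p%:R :> R.
Proof.
move=> N0; have := lerD (mertens_ge R N N0) (mertens_chi4_ge R N N0).
rewrite -big_split /=.
rewrite (eq_bigr (fun p => (1 + chi4 R p) * ln p%:R / p%:R)) => [|p _]; last first.
  by rewrite !mulrDl mul1r.
by move: (ln N%:R) (\sum_(_ <= _ < _ | _) _) => a b; lra.
Qed.

(** * The weight of prime factors of [n ^ 2 + 1] above [N] *)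

Lemma sqp1_count_ge (R : realType) (p N : nat) : prime p ->
  (1 + chi4 R p) * (N%:R / p%:R) - 2 <= (sqp1_count p N)%:R.
Proof.
move=> pp; have p0 : 0 < p%:R :> R by rewrite ltr0n prime_gt0.
have c1 := chi4_norm_le1 R p; rewrite ler_norml in c1.
have h : N%:R / p%:R - 1 <= (N %/ p)%:R :> R.
  rewrite lerBlDr ler_pdivrMr // natr1 -natrM ler_nat; apply: ltnW.
  by apply: ltn_ceil; rewrite prime_gt0.
(* Rounding [N / p] down costs at most the factor [1 + chi4 p <= 2]. This factor is the number of
   square roots of -1 modulo [p]: 1 for [p = 2], otherwise 2 or 0. *)
suff : (1 + chi4 R p) * (N %/ p)%:R <= (sqp1_count p N)%:R.
  move: h c1; move: (chi4 R p) (N%:R / p%:R) (N %/ p)%:R (sqp1_count p N)%:R.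
  by move=> c u v w h /andP[? ?]; nra.
have [->|p2] := eqVneq p 2%N.
  by rewrite /chi4 subrr addr0 mul1r ler_nat sqp1_count_2.
have /orP[/eqP p1|/eqP p3] : (p %% 4 == 1)%N || (p %% 4 == 3)%N.
- have op : odd p by case/even_prime: pp p2 => // ->.
  have := ltn_pmod p (isT : 0 < 4)%N; lia.
- by rewrite /chi4 p1 /= subr0 mulrC -(natrD _ 1 1) -natrM ler_nat sqp1_count_1mod4.
- by rewrite /chi4 p3 /= sub0r subrr mul0r.
Qed.

(** Total weight minus the weight of primes up to [N]. The constant is [31 = 1 + 22 + 8]: from
    [ln (N ^ 2 + 1) <= 2 ln N + 1], from Mertens, and from the counting error 2 per prime summed by
    [theta(N) <= 4 N]. *)
Lemma sqp1_large_primes_le (R : realType) (N : nat) : (0 < N)%N ->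
  \sum_(1 <= n < N.+1) \sum_(N.+1 <= p < (F N).+1 | prime p)
    (logn p (F n))%:R * ln p%:R <= N%:R * ln N%:R + 31 * N%:R :> R.
Proof.
move=> N0; have N0' : 0 < N%:R :> R by rewrite ltr0n.
have F0 n : (0 < F n)%N by rewrite /F addn1.
have FN n : (n <= N)%N -> (F n <= F N)%N by move=> nN; rewrite leq_add2r leq_exp2r.
have NF : (N <= F N)%N by rewrite /F; nia.
pose small n : R := \sum_(1 <= p < N.+1 | prime p) (logn p (F n))%:R * ln p%:R.
have -> : \sum_(1 <= n < N.+1) \sum_(N.+1 <= p < (F N).+1 | prime p)
    (logn p (F n))%:R * ln p%:R =
    \sum_(1 <= n < N.+1) ln (F n)%:R - \sum_(1 <= n < N.+1) small n.
  rewrite -sumrB; apply: eq_big_nat => n /andP[n0 nN].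
  rewrite (ln_sum_logn R (F n) (F N)) ?FN // (@big_cat_nat _ _ _ N.+1 1%N) //=.
  by rewrite [small n + _]addrC addrK.
have hT : \sum_(1 <= n < N.+1) ln (F n)%:R <= N%:R * (2 * ln N%:R + 1) :> R.
  rewrite mulr_natl -[X in _ *+ X](subn1 N.+1) -sumr_const_nat.
  apply: ler_sum_nat => n /andP[n0 nN].
  apply: (@le_trans _ _ (ln (F N)%:R)).
    by rewrite ler_ln ?posrE ?ltr0n // ler_nat FN.
  have -> : (F N)%:R = N%:R ^+ 2 * (1 + (N%:R ^+ 2)^-1) :> R.
    by rewrite /F natrD natrX mulrDr mulr1 divff // expf_neq0 // gt_eqF.
  have i0 : 0 < (N%:R ^+ 2)^-1 :> R by rewrite invr_gt0 exprn_gt0.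
  have i1 : (N%:R ^+ 2)^-1 <= 1 :> R by rewrite invf_le1 ?exprn_gt0 // exprn_ege1 // ler1n.
  rewrite lnM ?posrE ?exprn_gt0 ?addr_gt0 //.
  rewrite lnXn // mulr_natl lerD2l (le_trans _ i1) // le_ln1Dx //.
  by apply: lt_trans i0; rewrite ltrN10.
have hS : N%:R * (ln N%:R - 22) - 2 * (N%:R * 4) <= \sum_(1 <= n < N.+1) small n.
  rewrite exchange_big /=.
  apply: (@le_trans _ _ (\sum_(1 <= p < N.+1 | prime p)
     ((1 + chi4 R p) * (N%:R / p%:R) - 2) * ln p%:R)); last first.
    apply: ler_sum => p pp; rewrite -mulr_suml ler_wpM2r ?lnn_ge0 //.
    apply: le_trans (sqp1_count_ge R p N pp) _.
    (* A prime dividing [F n] is counted once, which is at most its multiplicity. *)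
    rewrite -natr_sum ler_nat; apply: leq_sum => n _.
    case: (boolP (p %| _)%N) => // h; rewrite -(expn1 p) pfactor_dvdn ?F0 // in h.
  have -> : \sum_(1 <= p < N.+1 | prime p)
     ((1 + chi4 R p) * (N%:R / p%:R) - 2) * ln p%:R =
     N%:R * \sum_(1 <= p < N.+1 | prime p) (1 + chi4 R p) * ln p%:R / p%:R -
     2 * \sum_(1 <= p < N.+1 | prime p) ln p%:R.
    by rewrite !mulr_sumr -sumrB; apply: eq_bigr => p _; ring.
  apply: lerB.
    by rewrite ler_wpM2l // mertens_1_plus_chi4_ge.
  rewrite ler_wpM2l // (le_trans (theta_le R N)) // ler_wpM2l //; exact: ln4_le.
move: hT hS; move: (\sum_(_ <= _ < _) _) (\sum_(_ <= _ < _) _) (ln N%:R) => a b c.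
by move: N%:R => d; lra.
Qed.

(** For each counted [n], the single prime [max_pdiv (F n) > y > N] already contributes at least
    [ln y] to the weight above [N]. *)
Lemma rough_count_le (R : realType) (N : nat) (y : R) : (0 < N)%N -> N%:R < y ->
  (\sum_(1 <= n < N.+1) (y < (Pplus (F n))%:R)%R)%N%:R * ln y <=
  N%:R * ln N%:R + 31 * N%:R :> R.
Proof.
move=> N0 Ny; apply: le_trans (sqp1_large_primes_le R N N0).
have y0 : 0 < y by apply: le_lt_trans Ny.
rewrite natr_sum mulr_suml; apply: ler_sum_nat => n /andP[n0 nN].
have s0 p : 0 <= (logn p (F n))%:R * ln p%:R :> R by rewrite mulr_ge0 ?lnn_ge0.
case: ltP => h; last by rewrite mul0r sumr_ge0.
rewrite mul1r /Pplus in h *; set p := max_pdiv (F n) in h.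
have F1 : (1 < F n)%N by rewrite /F addn1 ltnS expn_gt0 n0.
have pp : prime p by rewrite max_pdiv_prime.
have pN : (N < p)%N by rewrite -(ltr_nat R); apply: lt_trans h.
have pF : (p < (F N).+1)%N.
  rewrite ltnS (leq_trans (max_pdiv_leq _)) ?(ltnW F1) //.
  by rewrite leq_add2r leq_exp2r.
rewrite big_mkcond (bigD1_seq p) ?mem_index_iota ?pN ?iota_uniq //= pp.
apply: ler_wpDr; first by apply: sumr_ge0 => q _; case: ifP.
apply: (@le_trans _ _ (ln p%:R)).
  by rewrite ler_ln ?posrE ?ltr0n ?(leq_trans _ pN) // ltW.
rewrite -[X in X <= _]mul1r ler_wpM2r ?lnn_ge0 // ler1n.
by rewrite logn_gt0 mem_primes pp (ltnW F1) max_pdiv_dvd.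
Qed.

(** * Passing to the complement, and the theorem *)

Lemma Psi_F_add_rough (R : realType) (x y : R) :
  (Psi_F x y + \sum_(1 <= n < (Num.truncn x).+1) (y < (Pplus (F n))%:R)%R)%N = Num.truncn x.
Proof.
have -> : Psi_F x y = (\sum_(1 <= n < (Num.truncn x).+1) ((Pplus (F n))%:R <= y)%R)%N.
  rewrite /Psi_F -sum1dep_card big_mkcond /=.
  rewrite -(big_mkord xpredT
    (fun n => if (0 < n)%N && ((Pplus (F n))%:R <= y) then 1%N else 0%N)).
  rewrite big_ltn //= add0n; apply: eq_big_nat => n /andP[-> _].
  by case: (_ <= y).
rewrite -big_split /= (eq_bigr (fun=> 1%N)) => [|n _]; last by rewrite ltNge; case: (_ <= y).
by rewrite sum_nat_const_nat subn1 muln1.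
Qed.

Theorem mainTheorem3 (R : realType) :
  exists delta : R -> R,
    delta x @[x --> +oo] --> (0 : R) /\
    \forall x \near +oo, forall y : R,
      x < y -> y <= x ^+ 2 ->
      let u := ln x / ln y in
      2^-1 <= u -> u < 1 ->
      (1 - u + delta x) * x <= (Psi_F x y)%:R.
Proof.
(* The term [1/x] pays for rounding [x] down to [N], and [31 / ln x] for the linear error term
   divided by [ln y]. The error is uniform in [y]. *)
exists (fun x => - (x^-1 + 31 * (ln x)^-1)); split.
  rewrite -oppr0 -[X in - X](addr0 0) -[X in _ + X](mulr0 31).
  apply: cvgN; apply: cvgD.
    apply/gtr0_cvgV0 => //; near=> x; near: x; exact: nbhs_pinfty_gt.
  apply: cvgM; first exact: cvg_cst.
  apply/gtr0_cvgV0.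
    near=> x; rewrite ln_gt0 //; near: x; exact: nbhs_pinfty_gt.
  apply/cvgryPgt => A; near=> x.
  rewrite -[A]expRK ltr_ln ?posrE ?expR_gt0 //; near: x; exact: nbhs_pinfty_gt.
near=> x => y xy _ _ _; set u := ln x / ln y.
have x1 : 1 < x by near: x; exact: nbhs_pinfty_gt.
have x0 : 0 < x by lra.
have /andP[Nx xN] := truncn_itv (ltW x0).
have hP := Psi_F_add_rough R x y; set N := Num.truncn x in Nx xN hP.
have N0 : (0 < N)%N by rewrite -(ltr_nat R); move: xN; rewrite -natr1; lra.
have := rough_count_le R N y N0 (le_lt_trans Nx xy).
set B := (\sum_(_ <= _ < _) _)%N in hP * => hB.
have lx : 0 < ln x by rewrite ln_gt0.
have lxy : ln x <= ln y by rewrite ler_ln ?posrE ?ltW //; lra.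
have ly : 0 < ln y by apply: lt_le_trans lxy.
have -> : (Psi_F x y)%:R = N%:R - B%:R :> R by rewrite -[in RHS]hP natrD addrK.
(* Dividing [x ln x] by [ln y] gives exactly [u x]; in the error term [ln y] is replaced by the
   smaller [ln x]. *)
have hB' : B%:R <= u * x + 31 / ln x * x.
  apply: (@le_trans _ _ ((x * ln x + 31 * x) / ln y)).
    rewrite ler_pdivlMr //; apply: le_trans hB _.
    rewrite lerD ?ler_wpM2l // ler_pM // ?lnn_ge0 //.
    by rewrite ler_ln ?posrE ?ltr0n.
  rewrite mulrDl /u; apply: lerD; first by rewrite -mulrA mulrC.
  by rewrite [leRHS]mulrAC ler_wpM2l ?lef_pV2 // mulr_ge0 // ltW.
have e : (1 - u + - (x^-1 + 31 / ln x)) * x = x - 1 - (u * x + 31 / ln x * x).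
  by field; rewrite ?gt_eqF.
rewrite e; apply: lerB => //; rewrite lerBlDr natr1; exact: ltW.
Unshelve. all: by end_near. Qed.
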